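(* Let $n,k$ be integers with $3\le k\le n-2$, and let $\mathcal X$ be an $n$-independent set of $d(n,k-2)+3$ nodes in the plane. Then at most three linearly independent polynomials in $\Pi_k$ vanish at all nodes of $\mathcal X$. Moreover, there are three such linearly independent polynomials if and only if either all the nodes of $\mathcal X$ lie in a curve of degree $k-1$, or all the nodes of $\mathcal X$ but three lie in a curve of degree $k-2$ (which is then a maximal curve for $\mathcal X$).
   Context: $\Pi_n$ denotes the space of real bivariate polynomials of total degree at most $n$; $N_n=\frac12(n+1)(n+2)$ and $d(n,k):=N_n-N_{n-k}=\frac12 k(2n+3-k)$. A curve of degree $k$ is identified with a polynomial of degree $k$; a curve passes through a node if the polynomial vanishes there. For a finite node set $\mathcal X$ and $A\in\mathcal X$, $p\in\Pi_n$ is an $n$-fundamental polynomial of $A$ if $p(A)=1$ and $p$ vanishes on $\mathcal X\setminus\{A\}$; $\mathcal X$ is $n$-independent if every node has an $n$-fundamental polynomial. Given an $n$-independent $\mathcal X$ with $\#\mathcal X\ge d(n,k)$, a curve of degree $k\le n$ is maximal if it passes through exactly $d(n,k)$ nodes of $\mathcal X$. *)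

(* Defs.v *)
From HB Require Import structures.
From mathcomp Require Import all_boot all_order all_algebra.
From mathcomp Require Import reals.
From mathcomp Require Import mpoly.
Set Implicit Arguments.
Unset Strict Implicit.
Unset Printing Implicit Defensive.
Import Order.TTheory GRing.Theory Num.Theory.
Local Open Scope ring_scope.

Section Defs.
Variable R : realType.

Definition ev (p : {mpoly R[2]}) (A : R * R) : R :=
  p.@[fun i : 'I_2 => if val i == 0%N then A.1 else A.2].

(* Pi_n : polynomials of total degree at most n (msize p = 1 + deg p, msize 0 = 0). *)
Definition inPi (n : nat) (p : {mpoly R[2]}) : bool := (msize p <= n.+1)%N.

Definition curve (k : nat) (p : {mpoly R[2]}) : bool :=
  (p != 0) && (msize p == k.+1)%N.

Definition Ndim (n : nat) : nat := 'C(n.+2, 2).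
Definition dnk (n k : nat) : nat := (Ndim n - Ndim (n - k))%N.

Definition fundamental (n : nat) (X : seq (R * R)) (A : R * R)
    (p : {mpoly R[2]}) : Prop :=
  inPi n p /\ ev p A = 1 /\ (forall B, B \in X -> B != A -> ev p B = 0).

Definition n_independent (n : nat) (X : seq (R * R)) : Prop :=
  forall A, A \in X -> exists p, fundamental n X A p.

Definition nodes_on (X : seq (R * R)) (p : {mpoly R[2]}) : nat :=
  count (fun A => ev p A == 0) X.

Definition maximal_curve (n : nat) (X : seq (R * R)) (k : nat)
    (p : {mpoly R[2]}) : Prop :=
  curve k p /\ nodes_on X p = dnk n k.

Definition lin_indep (ps : seq {mpoly R[2]}) : Prop :=
  forall c : 'I_(size ps) -> R,
    \sum_(i < size ps) c i *: ps`_i = 0 -> forall i, c i = 0.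

Definition vanishes_on (X : seq (R * R)) (p : {mpoly R[2]}) : Prop :=
  forall A, A \in X -> ev p A = 0.

End Defs.

(* Main.v *)
Require Import Defs.
From HB Require Import structures.
From mathcomp Require Import all_boot all_order all_algebra.
From mathcomp Require Import boolp reals.
From mathcomp Require Import mpoly.
From mathcomp Require Import zify ring.
Set Implicit Arguments.
Unset Strict Implicit.
Unset Printing Implicit Defensive.
Import Order.TTheory GRing.Theory Num.Theory.
Local Open Scope ring_scope.

(* Choose a vertical line [x = a] that misses the nodes.  Restricting the curves
   of degree less than [d] through the nodes to this line gives a space of
   univariate polynomials; let [u d] be its dimension, counted as the number of
   degrees that occur.  The kernel of the restriction consists of the multiples
   of the line, so the [u j] add up to the dimensions of the spaces of curves,
   and [n]-independence gives [#X + u 0 + ... + u (n + 1) <= 'C(n + 2, 2)].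
   Multiplication by [y] shows that [u] is strictly increasing once it is
   positive.  Comparing sums, at most three independent curves of degree [k]
   exist, and if there are three while no curve of degree [k - 1] contains [X],
   then [u (k + 1) = 3] and [u (k + 2) = 4].  The three curves then restrict to
   [g, g y, g y^2], and a Hilbert-Burch argument writes them as a common factor
   [q] times three conics.  The same counting, applied to the nodes on and off
   [q], bounds their numbers by [d(n, k - 2)] and [3]. *)

(** * Bivariate polynomials, evaluation and total degree *)

Section Bivariate.

Variable F : fieldType.

Implicit Types (p q f g : {poly {poly F}}) (X : seq (F * F)).

(** The outer variable is the abscissa and the inner one the ordinate, so that restricting to a
    vertical line is a single evaluation with values in [{poly F}]. *)
Definition eval2 p (A : F * F) : F := p.[A.1%:P].[A.2].

(** A strict bound: [d = 0] leaves only the zero polynomial, which is where the inductions on the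
    degree start. *)
Definition tdeg_lt (d : nat) p : Prop :=
  forall i j, (d <= i + j)%N -> p`_i`_j = 0.

Definition scal (c : F) : {poly {poly F}} := c%:P%:P.

Definition ordinate : {poly {poly F}} := 'X%:P.

Lemma eval20 A : eval2 0 A = 0.
Proof. by rewrite /eval2 !horner0. Qed.

Lemma eval2D p q A : eval2 (p + q) A = eval2 p A + eval2 q A.
Proof. by rewrite /eval2 !hornerD. Qed.

Lemma eval2B p q A : eval2 (p - q) A = eval2 p A - eval2 q A.
Proof. by rewrite /eval2 !hornerE. Qed.

Lemma eval2M p q A : eval2 (p * q) A = eval2 p A * eval2 q A.
Proof. by rewrite /eval2 !hornerM. Qed.

Lemma eval2_scal c A : eval2 (scal c) A = c.
Proof. by rewrite /eval2 /scal !hornerC. Qed.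

Lemma eval2_sum (I : Type) (r : seq I) (G : I -> {poly {poly F}}) A :
  eval2 (\sum_(i <- r) G i) A = \sum_(i <- r) eval2 (G i) A.
Proof. by rewrite /eval2 !horner_sum. Qed.

Lemma tdeg_lt0 p : tdeg_lt 0 p -> p = 0.
Proof. by move=> p0; apply/polyP=> i; apply/polyP=> j; rewrite p0 // !coef0. Qed.

Lemma tdeg_ltW d e p : (d <= e)%N -> tdeg_lt d p -> tdeg_lt e p.
Proof. by move=> de pd i j /(leq_trans de)/pd. Qed.

Lemma tdeg_ltD d p q : tdeg_lt d p -> tdeg_lt d q -> tdeg_lt d (p + q).
Proof. by move=> pd qd i j ij; rewrite !coefD pd // qd // addr0. Qed.

Lemma tdeg_ltB d p q : tdeg_lt d p -> tdeg_lt d q -> tdeg_lt d (p - q).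
Proof. by move=> pd qd i j ij; rewrite !coefB pd // qd // subr0. Qed.

Lemma tdeg_ltM d e p q :
  tdeg_lt d.+1 p -> tdeg_lt e q -> tdeg_lt (d + e) (p * q).
Proof.
move=> pd qe i j ij; rewrite coefM coef_sum big1 // => u _.
rewrite coefM big1 // => v _.
have [duv|uvd] := ltnP d (u + v); first by rewrite pd ?mul0r.
rewrite qe ?mulr0 //; move: (ltn_ord u) (ltn_ord v) => ? ?; lia.
Qed.

Lemma tdeg_lt_scal c : tdeg_lt 1 (scal c).
Proof. by case=> [|i] [|j] // _; rewrite !coefC ?coef0. Qed.

Lemma tdeg_ltZ d c p : tdeg_lt d p -> tdeg_lt d (scal c * p).
Proof. exact: (@tdeg_ltM 0 d _ _ (@tdeg_lt_scal c)). Qed.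

Lemma tdeg_lt_sum (I : Type) (r : seq I) (G : I -> {poly {poly F}}) d :
  (forall i, tdeg_lt d (G i)) -> tdeg_lt d (\sum_(i <- r) G i).
Proof.
move=> Gd; apply: big_ind => //; last exact: tdeg_ltD.
by move=> i j _; rewrite !coef0.
Qed.

Lemma tdeg_lt_polyC (h : {poly F}) : tdeg_lt (size h) h%:P.
Proof.
by case=> [|i] j hj; rewrite coefC /= ?coef0 // nth_default.
Qed.

Lemma tdeg_lt_ordinate : tdeg_lt 2 ordinate.
Proof. by have := @tdeg_lt_polyC 'X; rewrite size_polyX. Qed.

(** One step of elimination by leading terms. When [h] is already shorter, the quotient of
    coefficients is [0] and nothing is subtracted. *)
Lemma size_sub_lead (h g : {poly F}) b : size g = b.+1 -> (size h <= b.+1)%N ->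
  (size (h - (h`_b / g`_b) *: g)%R <= b)%N.
Proof.
move=> szg szh; apply/leq_sizeP=> j; rewrite leq_eqVlt => /predU1P[<-|bj].
  rewrite coefB coefZ divfK ?subrr //.
  by have := lead_coef_eq0 g; rewrite lead_coefE szg /= => ->;
     rewrite -size_poly_eq0 szg.
rewrite coefB coefZ [g`_j]nth_default ?szg // mulr0 subr0.
by rewrite nth_default // (leq_trans szh).
Qed.

(** * Restriction to a vertical line *)

Section VerticalLine.

Variable a : F.

Definition xline : {poly {poly F}} := 'X - a%:P%:P.

Definition restr p : {poly F} := p.[a%:P].

Lemma restr0 : restr 0 = 0.
Proof. exact: horner0. Qed.

Lemma restrD p q : restr (p + q) = restr p + restr q.
Proof. exact: hornerD. Qed.

Lemma restrB p q : restr (p - q) = restr p - restr q.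
Proof. by rewrite /restr !hornerE. Qed.

Lemma restrM p q : restr (p * q) = restr p * restr q.
Proof. exact: hornerM. Qed.

Lemma restrC (h : {poly F}) : restr h%:P = h.
Proof. exact: hornerC. Qed.

Lemma restr_xline : restr xline = 0.
Proof. by rewrite /restr hornerXsubC subrr. Qed.

Lemma restrZ c p : restr (scal c * p) = c *: restr p.
Proof. by rewrite restrM restrC mul_polyC. Qed.

Lemma restrY p : restr (ordinate * p) = 'X * restr p.
Proof. by rewrite restrM restrC. Qed.

Lemma xline_neq0 : xline != 0.
Proof. by rewrite polyXsubC_eq0. Qed.

Lemma eval2_xline A : eval2 xline A = A.1 - a.
Proof. by rewrite /eval2 hornerXsubC -polyCB hornerC. Qed.

Lemma tdeg_lt_xline : tdeg_lt 2 xline.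
Proof.
move=> i j; rewrite coefB coefX coefC.
by case: i => [|[|i]]; case: j => [|[|j]] //= _;
  rewrite ?sub0r ?subr0 ?coefN ?coefB ?coef1 ?coefC ?coef0 ?oppr0 /=.
Qed.

Lemma tdeg_lt_xlineM d p : tdeg_lt d p -> tdeg_lt d.+1 (xline * p).
Proof. exact: (@tdeg_ltM 1 d _ _ tdeg_lt_xline). Qed.

(** Comparing coefficients in the abscissa, each coefficient of [p] is the next one of [xline * p]
    plus [a] times the next one of [p]. The bound therefore descends from the top coefficient; [s]
    measures the distance to [size p]. *)
Lemma tdeg_lt_xline_div d p : tdeg_lt d.+1 (xline * p) -> tdeg_lt d p.
Proof.
move=> lpd i; have [s] : {s | (size p <= i + s)%N}.
  by exists (size p); apply: leq_addl.
elim: s i => [|s IHs] i szp j dij.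
  by rewrite (nth_default _ _ : p`_i = 0) ?coef0 //; rewrite addn0 in szp.
have pi : p`_i = (xline * p)`_i.+1 + a *: p`_i.+1.
  by rewrite mulrBl coefB coefXM coefCM mul_polyC subrK.
by rewrite pi coefD coefZ lpd 1?IHs ?mulr0 ?addr0 //; lia.
Qed.

Lemma size_restr d p : tdeg_lt d p -> (size (restr p) <= d)%N.
Proof.
move=> pd; apply/leq_sizeP => j dj; rewrite /restr horner_coef coef_sum big1 //.
move=> i _; rewrite -polyC_exp mulrC coefCM pd ?mulr0 //.
exact: leq_trans dj (leq_addl _ _).
Qed.

Lemma restr_eq0 d p : tdeg_lt d.+1 p -> restr p = 0 ->
  exists2 q, tdeg_lt d q & p = xline * q.
Proof.
move=> pd /eqP/factor_theorem[q pq]; exists q; last by rewrite mulrC.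
by apply: tdeg_lt_xline_div; rewrite mulrC -[_ * _]pq.
Qed.

End VerticalLine.

(** * Spans of finite lists and linear dependence *)

Fixpoint inspan (gs : seq {poly {poly F}}) f : Prop :=
  if gs is g :: gs' then exists c, inspan gs' (f - scal c * g) else f = 0.

Lemma inspan1 c g : inspan [:: g] (scal c * g).
Proof. by exists c => /=; rewrite subrr. Qed.

Lemma inspan_cat gs hs f g :
  inspan gs f -> inspan hs g -> inspan (gs ++ hs) (f + g).
Proof.
elim: gs f => [|h gs IH] f /=; first by move->; rewrite add0r.
by case=> c fc gh; exists c; rewrite addrAC; apply: IH.
Qed.

Lemma inspan_map h gs f : inspan gs f -> inspan (map ( *%R h) gs) (h * f).
Proof.
elim: gs f => [|g gs IH] f /=; first by move->; rewrite mulr0.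
by case=> c /IH; rewrite mulrBr mulrCA; exists c.
Qed.

Lemma inspan_coef gs f : inspan gs f ->
  exists c : nat -> F, f = \sum_(i < size gs) scal (c i) * gs`_i.
Proof.
elim: gs f => [|g gs IH] f /=.
  by move->; exists (fun=> 0); rewrite big_ord0.
case=> c /IH[c' fc]; exists (fun i => if i is i'.+1 then c' i' else c).
by rewrite big_ord_recl /= -fc addrC subrK.
Qed.

(** The matrix of coefficients has more rows than columns, so its left kernel contains a nonzero
    vector. *)
Lemma inspan_dependent gs m (G : 'I_m -> {poly {poly F}}) :
  (size gs < m)%N -> (forall i, inspan gs (G i)) ->
  exists2 v : 'I_m -> F, exists i, v i != 0 & \sum_i scal (v i) * G i = 0.
Proof.
move=> gsm /(fun H i => inspan_coef (H i))/choice[c Gc].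
pose C := \matrix_(i < m, j < size gs) c i j.
have : kermx C != 0.
  rewrite -mxrank_eq0 mxrank_ker subn_eq0 -ltnNge.
  exact: leq_ltn_trans (rank_leq_col _) gsm.
case/rowV0Pn=> v /sub_kermxP vC v0.
exists (v 0).
  by apply/existsP; apply: contra_neqT v0 => /existsPn v0;
    apply/rowP=> i; rewrite mxE; apply/eqP/negPn/v0.
under eq_bigr => i _ do rewrite Gc big_distrr /=.
rewrite exchange_big big1 // => j _.
have vCj : \sum_i v 0 i * c i j = 0.
  have /matrixP/(_ 0 j) := vC; rewrite !mxE => vCj.
  by rewrite -[RHS]vCj; apply: eq_bigr => i _; rewrite mxE.
under eq_bigr => i _ do rewrite mulrA -!polyCM.
by rewrite -big_distrl /= -!rmorph_sum vCj !rmorph0 mul0r.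
Qed.

(** * Curves through the nodes and the dimensions of their restrictions *)

Section Nodes.

Variables (a : F) (X : seq (F * F)).
Hypothesis xlineX : forall A, A \in X -> A.1 != a.

Local Notation restr := (restr a).
Local Notation xline := (xline a).

Definition vanish p : Prop := forall A, A \in X -> eval2 p A = 0.

Definition ideal_lt (d : nat) p : Prop := tdeg_lt d p /\ vanish p.

Lemma ideal_ltD d p q : ideal_lt d p -> ideal_lt d q -> ideal_lt d (p + q).
Proof.
move=> [pd pX] [qd qX]; split; first exact: tdeg_ltD.
by move=> A AX; rewrite eval2D pX // qX // addr0.
Qed.

Lemma ideal_ltM d e p q :
  tdeg_lt d.+1 p -> ideal_lt e q -> ideal_lt (d + e) (p * q).
Proof.
move=> pd [qd qX]; split; first exact: tdeg_ltM.
by move=> A AX; rewrite eval2M qX // mulr0.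
Qed.

Lemma ideal_ltZ d c p : ideal_lt d p -> ideal_lt d (scal c * p).
Proof. exact: (@ideal_ltM 0 d _ _ (@tdeg_lt_scal c)). Qed.

Lemma ideal_ltB d p q : ideal_lt d p -> ideal_lt d q -> ideal_lt d (p - q).
Proof.
move=> [pd pX] [qd qX]; split; first exact: tdeg_ltB.
by move=> A AX; rewrite eval2B pX // qX // subr0.
Qed.

Lemma ideal_lt0 d : ideal_lt d 0.
Proof.
by split=> [i j _|A _]; rewrite ?coef0 ?eval20.
Qed.

Lemma ideal_ltW d e p : (d <= e)%N -> ideal_lt d p -> ideal_lt e p.
Proof. by move=> de [pd pX]; split=> //; apply: tdeg_ltW pd. Qed.

Lemma ideal_ltY d p : ideal_lt d p -> ideal_lt d.+1 (ordinate * p).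
Proof. exact: (@ideal_ltM 1 d _ _ tdeg_lt_ordinate). Qed.

(** The line misses the nodes, so dividing by it preserves vanishing on [X]. *)
Lemma ideal_restr_eq0 d p : ideal_lt d.+1 p -> restr p = 0 ->
  exists2 q, ideal_lt d q & p = xline * q.
Proof.
move=> [pd pX] /(restr_eq0 pd)[q qd pq]; exists q => //; split=> // A AX.
move: (pX A AX); rewrite pq eval2M eval2_xline => /eqP.
by rewrite mulf_eq0 subr_eq0 (negPf (xlineX AX)) => /eqP.
Qed.

Definition is_restr_deg (d e : nat) : bool :=
  `[< exists2 f, ideal_lt d f & size (restr f) = e.+1 >].

Definition restr_degs (d : nat) : seq nat := filter (is_restr_deg d) (iota 0 d).

Definition restr_dim (d : nat) : nat := size (restr_degs d).

Lemma is_restr_degP d e :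
  reflect (exists2 f, ideal_lt d f & size (restr f) = e.+1) (is_restr_deg d e).
Proof. exact: asboolP. Qed.

Lemma mem_restr_degs d e : (e \in restr_degs d) = is_restr_deg d e.
Proof.
rewrite mem_filter mem_iota /= add0n andb_idr // => /is_restr_degP[f [fd _] szf].
by rewrite -szf; apply: size_restr.
Qed.

(** An echelon basis: one curve is chosen for each degree below [b] that occurs, and leading terms
    are cancelled from the top. *)
Lemma restr_span d b : exists2 gs,
  size gs = count (is_restr_deg d) (iota 0 b) &
  forall f, ideal_lt d f -> (size (restr f) <= b)%N ->
    exists2 g, inspan gs g & ideal_lt d g /\ restr g = restr f.
Proof.
elim: b => [|b [gs szgs IH]].
  exists [::] => // f fd /=; rewrite leqn0 size_poly_eq0 => /eqP ->.
  exists 0 => //; split; first exact: ideal_lt0.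
  exact: restr0.
rewrite -addn1 iotaD count_cat -szgs /= add0n addn0.
case: (boolP (is_restr_deg d b)) => [/is_restr_degP[h hd szh]|nb].
  exists (gs ++ [:: h]); first by rewrite size_cat.
  move=> f fd; rewrite addn1 => /(size_sub_lead szh).
  set c := _ / _; rewrite -restrZ -restrB => /IH[|g gsg [gd rg]].
    by apply: ideal_ltB => //; apply: ideal_ltZ.
  exists (g + scal c * h); first by apply: inspan_cat => //; apply: inspan1.
  split; first by apply: ideal_ltD => //; apply: ideal_ltZ.
  by rewrite restrD rg restrB subrK.
exists gs; first by rewrite addn0.
move=> f fd szf; apply: IH => //; rewrite addn1 leq_eqVlt in szf.
case/predU1P: szf => // szf; case/negP: nb; apply/is_restr_degP; by exists f.
Qed.

(** Degrees below [b] that occur are cancelled by curves through the nodes, the others by powers of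
    the ordinate. Only the latter enter [gs], hence the complementary count. *)
Lemma restr_compl d b : (b <= d)%N -> exists2 gs,
  (size gs + count (is_restr_deg d) (iota 0 b))%N = b &
  forall f, tdeg_lt d f -> (size (restr f) <= b)%N ->
    exists2 g, inspan gs g & exists2 h, ideal_lt d h &
      tdeg_lt d (f - g - h) /\ restr (f - g - h) = 0.
Proof.
elim: b => [_|b IHb bd].
  exists [::] => // f fd /=; rewrite leqn0 size_poly_eq0 => /eqP f0.
  exists 0 => //; exists 0; first exact: ideal_lt0.
  by rewrite !subr0.
case: (IHb (ltnW bd)) => gs szgs IH.
rewrite -[in iota _ _]addn1 iotaD count_cat /= add0n addn0.
case: (boolP (is_restr_deg d b)) => [/is_restr_degP[h hd szh]|nb].
  exists gs; first by rewrite addnA szgs addn1.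
  move=> f fd /(size_sub_lead szh).
  set c := _ / _; rewrite -restrZ -restrB => /IH[|g gsg [h' h'd]].
    by apply: tdeg_ltB => //; apply: tdeg_ltZ; case: hd.
  exists g => //; exists (h' + scal c * h).
    by apply: ideal_ltD => //; apply: ideal_ltZ.
  by have -> : f - g - (h' + scal c * h) = f - scal c * h - g - h' by ring.
(* No restricted curve has degree [b], so the power of the ordinate itself joins the complement. *)
exists (gs ++ [:: ('X^b)%:P]); first by rewrite size_cat /= addn0 addnAC szgs addn1.
have szX : size (restr ('X^b)%:P) = b.+1 by rewrite restrC size_polyXn.
move=> f fd /(size_sub_lead szX).
set c := _ / _; rewrite -restrZ -restrB => /IH[|g gsg [h hd Hh]].
  apply: tdeg_ltB => //; apply: tdeg_ltZ; apply: (@tdeg_ltW b.+1) => //.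
  by rewrite -(size_polyXn F b); apply: tdeg_lt_polyC.
exists (g + scal c * ('X^b)%:P); first exact/inspan_cat/inspan1.
exists h => //.
by have -> : f - (g + scal c * ('X^b)%:P) - h = f - scal c * ('X^b)%:P - g - h
  by ring.
Qed.

(** A curve is first matched on the line by the echelon basis; the difference is [xline] times a
    curve of smaller degree through the nodes, to which induction applies. *)
Lemma ideal_span d : exists2 gs, size gs = (\sum_(j < d.+1) restr_dim j)%N &
  forall f, ideal_lt d f -> inspan gs f.
Proof.
elim: d => [|d [gs szgs IH]].
  exists [::]; first by rewrite big_ord1.
  by move=> f [/tdeg_lt0].
have [hs szhs Hhs] := restr_span d.+1 d.+1.
exists (map ( *%R xline) gs ++ hs).
  by rewrite size_cat size_map big_ord_recr /= szgs szhs -size_filter.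
move=> f fd.
have [|g hsg [gd rg]] := Hhs f fd; first by apply: size_restr; case: fd.
have [||q qd fgq] := @ideal_restr_eq0 d (f - g).
- exact: ideal_ltB.
- by rewrite restrB rg subrr.
- by rewrite -(subrK g f) fgq; apply: inspan_cat => //; apply/inspan_map/IH.
Qed.

(** The same induction for a complement of the curves through [X] in the space of all polynomials of
    degree less than [d], whose dimension is the sum on the right. *)
Lemma ideal_compl d : exists2 gs,
  (size gs + \sum_(j < d.+1) restr_dim j = \sum_(j < d.+1) j)%N &
  forall f, tdeg_lt d f -> exists2 g, inspan gs g & ideal_lt d (f - g).
Proof.
elim: d => [|d [gs szgs IH]].
  exists [::]; first by rewrite !big_ord1.
  by move=> f /tdeg_lt0 ->; exists 0 => //; rewrite subr0; apply: ideal_lt0.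
have [hs szhs Hhs] := restr_compl (leqnn d.+1).
exists (map ( *%R xline) gs ++ hs).
  rewrite -size_filter in szhs.
  by rewrite size_cat size_map big_ord_recr [RHS]big_ord_recr -[X in _ = _ + X]szhs
    -szgs addnACA.
move=> f fd; have [g hsg [h hd [fghd]]] := Hhs f fd (size_restr a fd).
case/(restr_eq0 fghd)=> q qd fghq; have [g' gsg' g'd] := IH q qd.
exists (xline * g' + g); first by apply: inspan_cat => //; apply: inspan_map.
have -> : f - (xline * g' + g) = xline * (q - g') + h.
  by rewrite mulrBr -fghq; ring.
by apply: ideal_ltD => //; apply: (@ideal_ltM 1) => //; apply: tdeg_lt_xline.
Qed.

(** As in [tdeg_lt] the bound is strict, so [n]-independence becomes [independent n.+1]. *)
Definition independent (d : nat) : Prop := forall A, A \in X ->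
  exists2 p, tdeg_lt d p & eval2 p A = 1 /\
    forall B, B \in X -> B != A -> eval2 p B = 0.

(** Reducing the fundamental polynomials to the complement of the ideal does not change their values
    on [X]. If the complement had fewer generators than [X] has nodes, the reduced polynomials would
    be dependent; evaluating the relation at a node kills its coefficient. *)
Lemma independent_size d : uniq X -> independent d ->
  (size X + \sum_(j < d.+1) restr_dim j <= 'C(d.+1, 2))%N.
Proof.
move=> Xu Xd; have [gs szgs Hgs] := ideal_compl d.
rewrite -bin2_sum big_mkord -szgs leq_add2r leqNgt; apply/negP=> gsX.
have /choice[G HG] (i : 'I_(size X)) : exists g, inspan gs g /\
    exists2 p, ideal_lt d (p - g) & forall j : 'I_(size X),
      eval2 p (tnth (in_tuple X) j) = (j == i)%:R.
  have [p pd [p1 p0]] := Xd _ (mem_tnth i (in_tuple X)).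
  have [g gsg pgd] := Hgs p pd; exists g; split=> //; exists p => // j.
  case: eqVneq => [->//|ji]; apply: p0; first exact: mem_tnth.
  by rewrite (inj_eq (elimT (tuple_uniqP (in_tuple X)) Xu)).
have [i|v [i vi] vG] := inspan_dependent gsX (G := G); first by case: (HG i).
case/eqP: vi; have := congr1 (eval2^~ (tnth (in_tuple X) i)) vG.
rewrite /= eval2_sum eval20 (bigD1 i) //= big1 => [|j ji].
  rewrite addr0; case: (HG i) => _ [p [_ pgX] pE].
  move: (pgX _ (mem_tnth i (in_tuple X))); rewrite eval2B pE eqxx => /eqP.
  by rewrite subr_eq0 eval2M eval2_scal => /eqP <-; rewrite mulr1.
case: (HG j) => _ [p [_ pgX] pE].
move: (pgX _ (mem_tnth i (in_tuple X))); rewrite eval2B pE.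
rewrite eq_sym (negPf ji) sub0r => /eqP; rewrite oppr_eq0 => /eqP g0.
by rewrite eval2M g0 mulr0.
Qed.

Lemma restr_degs_uniq d : uniq (restr_degs d).
Proof. by rewrite filter_uniq ?iota_uniq. Qed.

Lemma restr_degs_sorted d : sorted ltn (restr_degs d).
Proof. by rewrite sorted_filter ?iota_ltn_sorted //; apply: ltn_trans. Qed.

Lemma restr_degsW d e : e \in restr_degs d -> e \in restr_degs d.+1.
Proof.
rewrite !mem_restr_degs => /is_restr_degP[f fd szf].
by apply/is_restr_degP; exists f => //; apply: ideal_ltW fd.
Qed.

Lemma restr_degsS d e : e \in restr_degs d -> e.+1 \in restr_degs d.+1.
Proof.
rewrite !mem_restr_degs => /is_restr_degP[f fd szf].
apply/is_restr_degP; exists (ordinate * f); first exact: ideal_ltY.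
by rewrite restrY mulrC size_mulX -?size_poly_eq0 szf.
Qed.

(** Old degrees persist, and multiplication by the ordinate shifts each of them up by one. The least
    degree [e] is not a shifted one, which gives one more degree than before. *)
Lemma restr_degs_next d e s : restr_degs d = e :: s ->
  uniq (e :: map S (e :: s)) /\
  {subset e :: map S (e :: s) <= restr_degs d.+1}.
Proof.
move=> ds; split.
  have /(order_path_min ltn_trans)/allP es : path ltn e s.
    by have := restr_degs_sorted d; rewrite ds.
  rewrite cons_uniq -/(map S (e :: s)) map_inj_uniq; last exact: succn_inj.
  rewrite -ds restr_degs_uniq andbT; apply/negP=> /mapP[x].
  by rewrite ds inE => /predU1P[->|/es]; lia.
move=> x; rewrite inE => /predU1P[->|/mapP[y ys ->]].
  by apply: restr_degsW; rewrite ds mem_head.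
by apply: restr_degsS; rewrite ds.
Qed.

Lemma restr_dimS d : (0 < restr_dim d)%N -> (restr_dim d < restr_dim d.+1)%N.
Proof.
rewrite /restr_dim; case ds: (restr_degs d) => [|e s] // _.
have [u sub] := restr_degs_next ds.
by have := uniq_leq_size u sub; rewrite /= size_map.
Qed.

Lemma restr_dim_addn d c t : (0 < c)%N -> (c <= restr_dim d)%N ->
  (c + t <= restr_dim (d + t))%N.
Proof.
move=> c0 cd; elim: t => [|t IH]; first by rewrite !addn0.
by rewrite !addnS; apply: (leq_ltn_trans IH); apply: restr_dimS; lia.
Qed.

Lemma sum_restr_dim d c r : (0 < c)%N -> (c <= restr_dim d)%N ->
  (\sum_(t < r) (c + t) <= \sum_(t < r) restr_dim (d + t))%N.
Proof. by move=> c0 cd; apply: leq_sum => t _; apply: restr_dim_addn. Qed.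

End Nodes.

End Bivariate.

(** * Hilbert-Burch: a common factor times three conics *)

Section Conics.

Variables (F : fieldType) (a : F) (X : seq (F * F)).
Hypothesis xlineX : forall A, A \in X -> A.1 != a.

Implicit Types (p q f g : {poly {poly F}}).

Local Notation ordinate := (ordinate F).
Local Notation restr := (restr a).
Local Notation xline := (xline a).
Local Notation ideal_lt := (ideal_lt X).
Local Notation restr_degs := (restr_degs a X).
Local Notation restr_dim := (restr_dim a X).

(* The restriction to the line determines [q] modulo [xline]; dividing by
   [xline] lowers the degree. *)
Lemma common_factor d M1 M3 f1 f3 :
  tdeg_lt 3 M1 -> tdeg_lt 3 M3 -> restr M1 = 1 -> restr M3 = 'X^2 ->
  tdeg_lt d f1 -> tdeg_lt d f3 -> f1 * M3 = f3 * M1 ->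
  exists2 q, tdeg_lt (d - 2) q & f1 = q * M1 /\ f3 = q * M3.
Proof.
move=> M1d M3d rM1 rM3; elim: d f1 f3 => [|d IH] f1 f3 f1d f3d f13.
  exists 0; first by move=> i j _; rewrite !coef0.
  by rewrite !mul0r; split; apply: tdeg_lt0.
(* [h] is what [q] has to restrict to. Its degree is bounded through [f3], whose restriction is [h]
   times the square of the ordinate. *)
pose h := restr f1.
have rf3 : restr f3 = h * 'X^2.
  by have := congr1 restr f13; rewrite !restrM rM1 rM3 mulr1.
have szh : h != 0 -> (size h + 2 <= d.+1)%N.
  move=> h0; have := size_restr a f3d.
  by rewrite rf3 size_mulXn // addnC.
have hd : tdeg_lt (d.+1 - 2) h%:P.
  have [->|/szh szh'] := eqVneq h 0; first by move=> i j _; rewrite polyC0 !coef0.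
  by apply: tdeg_ltW (@tdeg_lt_polyC _ h); lia.
have hMd M : tdeg_lt 3 M -> tdeg_lt d.+1 (h%:P * M).
  move=> Md; have [->|/szh szh'] := eqVneq h 0.
    by move=> i j _; rewrite polyC0 mul0r !coef0.
  rewrite mulrC; apply: tdeg_ltW (tdeg_ltM Md (@tdeg_lt_polyC _ h)); lia.
have [||g1 g1d fg1] := @restr_eq0 _ a d (f1 - h%:P * M1).
- by apply: tdeg_ltB => //; apply: hMd.
- by rewrite restrB restrM restrC rM1 mulr1 subrr.
have [||g3 g3d fg3] := @restr_eq0 _ a d (f3 - h%:P * M3).
- by apply: tdeg_ltB => //; apply: hMd.
- by rewrite restrB restrM restrC rM3 rf3 subrr.
have [//|//||q qd [gq1 gq3]] := IH g1 g3.
  apply: (mulfI (xline_neq0 a)); rewrite !mulrA -fg1 -fg3 !mulrBl f13; ring.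
exists (h%:P + xline * q).
  (* For [d < 2] the truncated [d - 2] is [0], which forces the inductive [q] to vanish. *)
  apply: tdeg_ltD => //; have [d2|d2] := ltnP d 2; last first.
    by rewrite subSn //; apply: tdeg_lt_xlineM.
  have -> : q = 0 by apply: tdeg_lt0; move: qd; have -> : (d - 2)%N = 0%N by lia.
  by move=> i j _; rewrite mulr0 !coef0.
split; first by rewrite -[LHS](subrK (h%:P * M1)) fg1 gq1; ring.
by rewrite -[LHS](subrK (h%:P * M3)) fg3 gq3; ring.
Qed.

(** Degrees [x < y < z] yield [x], [x.+1], [y.+1], [z.+1] one step later, and these are all four.
    Since [y] and [z] persist, they must be among them, which leaves only [y = x.+1] and
    [z = x.+2]. *)
Lemma restr_degs_consecutive d :
  restr_dim d = 3%N -> restr_dim d.+1 = 4%N ->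
  exists x, restr_degs d = [:: x; x.+1; x.+2] /\
    restr_degs d.+1 =i [:: x; x.+1; x.+2; x.+3].
Proof.
rewrite /restr_dim => d3 d4.
have := restr_degs_sorted a X d.
case ds: (restr_degs d) d3 => [|x [|y [|z [|//]]]] //= _ /and3P[xy yz _].
have [u sub] := restr_degs_next ds.
have [|_ eqd] := uniq_min_size u sub; first by rewrite d4.
have yd : y \in restr_degs d.+1 by apply: restr_degsW; rewrite ds !inE eqxx orbT.
have zd : z \in restr_degs d.+1 by apply: restr_degsW; rewrite ds !inE eqxx !orbT.
move: yd zd; rewrite -!eqd !inE => yd zd.
have yE : y = x.+1 by lia.
have zE : z = x.+2 by lia.
by exists x; split=> [|e]; rewrite ?yE ?zE // -eqd yE zE.
Qed.

(** If raising the degree bound by one creates no new restricted degree below [b], elimination by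
    leading terms can be carried out with curves satisfying the lower bound. *)
Lemma restr_lift d b f : (forall e, (e < b)%N -> e \in restr_degs d.+1 ->
    e \in restr_degs d) ->
  ideal_lt d.+1 f -> (size (restr f) <= b)%N ->
  exists2 g, ideal_lt d g & restr g = restr f.
Proof.
elim: b f => [|b IH] f sub fd.
  rewrite leqn0 size_poly_eq0 => /eqP ->; exists 0; first exact: ideal_lt0.
  exact: restr0.
rewrite leq_eqVlt => /predU1P[szf|szf]; last first.
  by apply: IH => // e eb; apply: sub; apply: ltnW.
have : b \in restr_degs d.
  by apply: sub => //; rewrite mem_restr_degs; apply/is_restr_degP; exists f.
rewrite mem_restr_degs => /is_restr_degP[h hd szh].
have := size_sub_lead szh (eq_leq szf).
set c := _ / _; rewrite -restrZ -restrB => /IH[||g gd rg].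
- by move=> e eb; apply: sub; apply: ltnW.
- by apply: ideal_ltB => //; apply/ideal_ltZ/(ideal_ltW (leqnSn d)).
exists (g + scal c * h); first exact/ideal_ltD/ideal_ltZ.
by rewrite restrD rg restrB subrK.
Qed.

(* The Hilbert-Burch argument: the restrictions [g, g 'X, g 'X^2] yield two
   linear syzygies between the curves, whose 2x2 minors are the conics. *)
Lemma factor_through_conics d :
  restr_dim d.+1 = 3%N -> restr_dim d.+2 = 4%N ->
  (forall p, ideal_lt d p -> p = 0) ->
  exists q M1 M2 M3,
    [/\ tdeg_lt (d.+1 - 2) q, restr q != 0,
        [/\ restr M1 = 1, restr M2 = 'X & restr M3 = 'X^2],
        [/\ tdeg_lt 3 M1, tdeg_lt 3 M2 & tdeg_lt 3 M3] &
        [/\ vanish X (q * M1), vanish X (q * M2) & vanish X (q * M3)]].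
Proof.
move=> d3 d4 d0; have [x [ds eqd]] := restr_degs_consecutive d3 d4.
(* The only new degree is [x.+3], so restrictions of lower degree already come from curves in
   [ideal_lt d.+1]. *)
have sub e : (e < x.+3)%N -> e \in restr_degs d.+2 -> e \in restr_degs d.+1.
  by move=> ex; rewrite eqd ds !inE; lia.
have restr_inj p : ideal_lt d.+1 p -> restr p = 0 -> p = 0.
  by move=> pd /(ideal_restr_eq0 xlineX pd)[q /d0 -> ->]; rewrite mulr0.
have [f1 f1d sz1] : exists2 f, ideal_lt d.+1 f & size (restr f) = x.+1.
  by apply/is_restr_degP; rewrite -mem_restr_degs ds mem_head.
have f10 : restr f1 != 0 by rewrite -size_poly_eq0 sz1.
have [|f2 f2d] := restr_lift sub (ideal_ltY f1d).
  by rewrite restrY mulrC size_mulX // sz1.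
rewrite restrY => rf2.
have sz2 : size (restr f2) = x.+2 by rewrite rf2 mulrC size_mulX // sz1.
have f20 : restr f2 != 0 by rewrite -size_poly_eq0 sz2.
have [|f3 f3d] := restr_lift sub (ideal_ltY f2d).
  by rewrite restrY mulrC size_mulX // sz2.
rewrite restrY => rf3.
have sz3 : size (restr f3) = x.+3 by rewrite rf3 mulrC size_mulX // sz2.
(* [f1], [f2], [f3] realise every restricted degree, and restriction is injective on
   [ideal_lt d.+1]; hence they span it. *)
have comb h : ideal_lt d.+1 h ->
    exists c1 c2 c3, h = scal c1 * f1 + scal c2 * f2 + scal c3 * f3.
  move=> hd; have degh p : ideal_lt d.+1 p -> restr p != 0 ->
      (x < size (restr p) <= x.+3)%N.
    move=> pd; rewrite -size_poly_gt0 => p0.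
    have : (size (restr p)).-1 \in restr_degs d.+1.
      rewrite mem_restr_degs; apply/is_restr_degP; exists p => //.
      by rewrite prednK.
    by rewrite ds !inE; lia.
  have szh : (size (restr h) <= x.+3)%N.
    by have [->|/(degh _ hd)/andP[]//] := eqVneq (restr h) 0; rewrite size_poly0.
  have := size_sub_lead sz3 szh; set c3 := _ / _; rewrite -restrZ -restrB => szh3.
  have := size_sub_lead sz2 szh3; set c2 := _ / _; rewrite -restrZ -restrB => szh2.
  have := size_sub_lead sz1 szh2; set c1 := _ / _; rewrite -restrZ -restrB => szh1.
  exists c1, c2, c3; apply/eqP; rewrite -subr_eq0.
  have -> : h - (scal c1 * f1 + scal c2 * f2 + scal c3 * f3)
    = h - scal c3 * f3 - scal c2 * f2 - scal c1 * f1 by ring.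
  have rd : ideal_lt d.+1 (h - scal c3 * f3 - scal c2 * f2 - scal c1 * f1).
    by do 3 (apply: ideal_ltB; last exact: ideal_ltZ).
  apply/eqP/restr_inj => //; apply/eqP; apply: contraTT szh1 => /(degh _ rd).
  by rewrite -ltnNge => /andP[].
have syz f g : ideal_lt d.+1 f -> ideal_lt d.+1 g -> restr g = 'X * restr f ->
    exists c1 c2 c3, ordinate * f - g =
      xline * (scal c1 * f1 + scal c2 * f2 + scal c3 * f3).
  move=> fd gd rg.
  have [||h hd ->] := @ideal_restr_eq0 _ a X xlineX d.+1 (ordinate * f - g).
  - by apply: ideal_ltB; [apply: ideal_ltY | apply: ideal_ltW gd].
  - by rewrite restrB restrY rg subrr.
  - by have [c1 [c2 [c3 ->]]] := comb h hd; exists c1, c2, c3.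
have [a1 [a2 [a3 Ea]]] := syz f1 f2 f1d f2d rf2.
have [b1 [b2 [b3 Eb]]] := syz f2 f3 f2d f3d rf3.
(* Up to sign, [M1], [M2], [M3] are the 2x2 minors of the matrix of the two syzygies, with rows
   [(ordinate - l a1, - (1 + l a2), - l a3)] and [(- l b1, ordinate - l b2, - (1 + l b3))]. On the
   line every [l c] vanishes, which leaves [1], ['X], ['X^2]. *)
pose l c := scal c * xline.
pose M1 := (1 + l a2) * (1 + l b3) + l a3 * (ordinate - l b2).
pose M2 := (ordinate - l a1) * (1 + l b3) + l a3 * l b1.
pose M3 := (ordinate - l a1) * (ordinate - l b2) - l b1 * (1 + l a2).
have r1 : restr 1 = 1 by rewrite restrC.
have rY : restr ordinate = 'X by rewrite restrC.
have ld c : tdeg_lt 2 (l c) by apply: tdeg_ltZ; apply: tdeg_lt_xline.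
have d1 : tdeg_lt 2 (1 : {poly {poly F}}).
  exact: tdeg_ltW (@tdeg_lt_scal F 1).
have dY := @tdeg_lt_ordinate F.
have dM p q : tdeg_lt 2 p -> tdeg_lt 2 q -> tdeg_lt 3 (p * q).
  exact: (@tdeg_ltM _ 1 2).
have M1d : tdeg_lt 3 M1.
  by apply: tdeg_ltD; apply: dM => //; (apply: tdeg_ltB || apply: tdeg_ltD).
have M2d : tdeg_lt 3 M2.
  by apply: tdeg_ltD; apply: dM => //; (apply: tdeg_ltB || apply: tdeg_ltD).
have M3d : tdeg_lt 3 M3.
  by apply: tdeg_ltB; apply: dM => //; (apply: tdeg_ltB || apply: tdeg_ltD).
have rE := (restr_xline, rY, r1, restrB, restrD, restrM).
have rM1 : restr M1 = 1 by rewrite /M1 /l !rE; ring.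
have rM2 : restr M2 = 'X by rewrite /M2 /l !rE; ring.
have rM3 : restr M3 = 'X^2 by rewrite /M3 /l !rE; ring.
have M10 : M1 != 0.
  by apply: contra_eq_neq rM1 => ->; rewrite restr0 eq_sym oner_neq0.
(* Cramer's rule: this combination of the two syzygies eliminates [f3]; the one for [E13] eliminates
   [f2]. *)
have E12 : f1 * M2 = f2 * M1.
  apply/eqP; rewrite -subr_eq0; apply/eqP.
  transitivity ((1 + l b3) * (ordinate * f1 - f2
      - xline * (scal a1 * f1 + scal a2 * f2 + scal a3 * f3))
      - l a3 * (ordinate * f2 - f3
      - xline * (scal b1 * f1 + scal b2 * f2 + scal b3 * f3))).
    by rewrite /M1 /M2 /l; ring.
  by rewrite Ea Eb !subrr !mulr0 subrr.
have E13 : f1 * M3 = f3 * M1.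
  apply/eqP; rewrite -subr_eq0; apply/eqP.
  transitivity ((ordinate - l b2) * (ordinate * f1 - f2
      - xline * (scal a1 * f1 + scal a2 * f2 + scal a3 * f3))
      + (1 + l a2) * (ordinate * f2 - f3
      - xline * (scal b1 * f1 + scal b2 * f2 + scal b3 * f3))).
    by rewrite /M1 /M3 /l; ring.
  by rewrite Ea Eb !subrr !mulr0 addr0.
have [q qd [f1q f3q]] := common_factor M1d M3d rM1 rM3 f1d.1 f3d.1 E13.
have f2q : f2 = q * M2.
  by apply: (mulIf M10); rewrite -E12 f1q mulrAC.
exists q, M1, M2, M3; split=> //.
  by move: f10; rewrite f1q restrM rM1 mulr1.
by rewrite -f1q -f2q -f3q; split; [case: f1d | case: f2d | case: f3d].
Qed.

End Conics.

(** * Counting nodes on and off a curve *)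

Section NodeCounts.

Variable F : fieldType.

Implicit Types (p q f g : {poly {poly F}}) (X : seq (F * F)).

Lemma independent_sub X Y d :
  {subset Y <= X} -> independent X d -> independent Y d.
Proof.
move=> sub Xd A /sub/Xd[p pd [p1 p0]]; exists p => //.
by split=> // B /sub; apply: p0.
Qed.

(** Each factor [xline a] raises the total degree by exactly one, so enough factors fill the gap up
    to degree [d]. *)
Lemma exists_exact_degree a d q : q != 0 -> tdeg_lt d.+1 q ->
  exists i, tdeg_lt d.+1 (xline a ^+ i * q) /\ ~ tdeg_lt d (xline a ^+ i * q).
Proof.
move=> q0; elim: d => [|d IH] qd.
  exists 0%N; rewrite expr0 mul1r; split=> // /tdeg_lt0 q0'.
  by rewrite q0' eqxx in q0.
have [qd'|] := pselect (tdeg_lt d.+1 q); last first.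
  by exists 0%N; rewrite expr0 mul1r.
have [i [qi nqi]] := IH qd'; exists i.+1; rewrite exprS -mulrA.
by split; [apply: tdeg_lt_xlineM | move/tdeg_lt_xline_div].
Qed.

Lemma sum_addn_ord c r : (\sum_(t < r) (c + t) = r * c + \sum_(t < r) t)%N.
Proof. by rewrite big_split /= sum_nat_const card_ord. Qed.

Lemma sum_S_ord r : (\sum_(t < r) (1 + t) = 'C(r.+1, 2))%N.
Proof. by rewrite -bin2_sum big_mkord big_ord_recl add0n. Qed.

(** The curve makes the restricted dimension positive at [k - 1], so from there to [n.+1] the
    dimensions are at least [1, 2, 3, ...]. Their sum is at least the dimension of the space of
    degree [n - (k - 2)]; the rest of the budget is [dnk n (k - 2)]. *)
Lemma size_on_curve a X n k q : (3 <= k)%N -> (k <= n - 2)%N ->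
  uniq X -> independent X n.+1 -> tdeg_lt (k - 1) q ->
  vanish X q -> restr a q != 0 ->
  (size X <= dnk n (k - 2))%N.
Proof.
move=> k3 kn Xu Xn qd qX q0; have := independent_size a Xu Xn.
have u0 : (0 < restr_dim a X (k - 1))%N.
  rewrite /restr_dim -has_predT; apply/hasP; exists (size (restr a q)).-1 => //.
  rewrite mem_restr_degs; apply/is_restr_degP; exists q => //.
  by rewrite prednK // size_poly_gt0.
have := sum_restr_dim (n - k).+3 (isT : (0 < 1)%N) u0.
rewrite sum_S_ord /dnk /Ndim.
have -> : n.+2 = ((k - 1) + (n - k).+3)%N by lia.
rewrite big_split_ord /=.
have -> : (n - (k - 2)).+2 = (n - k).+4 by lia.
set s1 := (\sum_(i < _) _)%N; set s2 := (\sum_(i < _) _)%N; lia.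
Qed.

Section Dimensions.

Variables (a : F) (X : seq (F * F)) (n k : nat).
Hypothesis xlineX : forall A, A \in X -> A.1 != a.
Hypotheses (k3 : (3 <= k)%N) (kn : (k <= n - 2)%N).
Hypotheses (Xu : uniq X) (Xn : independent X n.+1).

Local Notation u := (restr_dim a X).

Hypothesis szX : size X = (dnk n (k - 2) + 3)%N.

(** The budget for the sum of the [u j] is [1 + 2 + ... + (n - k + 3)] minus [3]. Strict growth from
    a positive value at [k - 1] would use up at least the whole sum, without the deficit of [3]; the
    other claims compare in the same way. *)
Lemma restr_dim_main :
  [/\ forall j, (j < k)%N -> u j = 0%N,
      (0 < u k)%N -> (u k + u k.+1 <= 3)%N,
      u k = 0%N -> (u k.+1 <= 3)%N &
      u k = 0%N -> u k.+1 = 3%N -> u k.+2 = 4%N].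
Proof.
pose r := (n - k).-1; pose T := (\sum_(t < r) t)%N.
pose tail := (\sum_(t < r) u (k.+3 + t))%N.
(* Here [10 = 1 + 2 + 3 + 4] belongs to the indices [k - 1] to [k.+2], and [r * 5 + T] to the [r]
   remaining ones up to [n.+1], where the comparison values start at [5]. Once [u k.+2] is at least
   [4], the tail cancels against the latter and the four values sum to at most [7]. *)
have key : (u (k - 1) + u k + u k.+1 + u k.+2 + tail + 3 <= 10 + (r * 5 + T))%N.
  have := independent_size a Xu Xn; rewrite szX /dnk /Ndim.
  have le_bin : ('C((n - (k - 2)).+2, 2) <= 'C(n.+2, 2))%N.
    by apply: leq_bin2l; lia.
  have -> : (\sum_(j < n.+2) u j)%N = (\sum_(j < k - 1) u j +
      (u (k - 1) + u k + u k.+1 + u k.+2 + tail))%N.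
    have -> : n.+2 = ((k - 1) + (4 + r))%N by rewrite /r; lia.
    rewrite big_split_ord /= big_split_ord /= 4!big_ord_recl big_ord0 /=.
    rewrite /bump /= !addn0 /tail; congr addn; congr addn.
      by rewrite addnS !addnA; congr (_ + u _ + u _ + u _)%N; lia.
    by apply: eq_bigr => t _; congr u; lia.
  have : 'C((n - (k - 2)).+2, 2) = (10 + (r * 5 + T))%N.
    have -> : (n - (k - 2)).+2 = (4 + r).+1 by rewrite /r; lia.
    rewrite -sum_S_ord big_split_ord /= 4!big_ord_recl big_ord0 /= -sum_addn_ord.
    by congr addn; apply: eq_bigr => t _; lia.
  move: le_bin; set b1 := 'C(_, _); set b2 := 'C(_, _); move: (\sum_(j < _) _)%N.
  lia.
have tailP : (4 <= u k.+2)%N -> (r * 5 + T <= tail)%N.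
  move=> u4; rewrite -sum_addn_ord; apply: sum_restr_dim => //.
  by have := @restr_dimS _ a X k.+2; lia.
have kk : k = (k - 1).+1 by lia.
have s0 := @restr_dimS _ a X (k - 1); rewrite -kk in s0.
have s1 := @restr_dimS _ a X k.
have s2 := @restr_dimS _ a X k.+1.
have u0 : u (k - 1) = 0%N by lia.
split; try lia.
move=> j jk; apply/eqP; rewrite -leqn0 leqNgt; apply/negP=> uj.
have := restr_dim_addn (k - 1 - j) (isT : (0 < 1)%N) uj.
by rewrite (_ : (j + (k - 1 - j))%N = (k - 1)%N) ?u0 //; lia.
Qed.

Lemma sum_restr_dimE : (\sum_(j < k.+2) u j = u k + u k.+1)%N.
Proof.
have [u0 _ _ _] := restr_dim_main.
by rewrite !big_ord_recr /= big1 // => j _; apply: u0.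
Qed.

Lemma sum_restr_dim_le3 : (\sum_(j < k.+2) u j <= 3)%N.
Proof. by rewrite sum_restr_dimE; have [_ u1 u2 _] := restr_dim_main; lia. Qed.

(** If [u k] is positive, some curve of degree less than [k] contains [X]. Otherwise the dimensions
    [3] and [4] give a factor [q]; at most [3] nodes lie off it and at most [dnk n (k - 2)] on it,
    and the size of [X] makes both bounds equalities. *)
Lemma curve_alternative : (3 <= \sum_(j < k.+2) u j)%N ->
  (exists2 q, q != 0 & ideal_lt X k q) \/
  (exists q, [/\ q != 0, tdeg_lt (k - 1) q,
     count (fun A => eval2 q A != 0) X = 3%N &
     count (fun A => eval2 q A == 0) X = dnk n (k - 2)]).
Proof.
have [u0 _ u3 u4] := restr_dim_main.
rewrite sum_restr_dimE => s3; have [uk|uk] := posnP (u k); last first.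
  left; move: uk; rewrite /restr_dim -has_predT => /hasP[e].
  rewrite mem_restr_degs => /is_restr_degP[f fk szf] _; exists f => //.
  by apply: contra_eq_neq szf => ->; rewrite restr0 size_poly0.
have uk1 : u k.+1 = 3%N by have := u3 uk; lia.
right; have [||p|q [M1 [M2 [M3 [qd q0 [r1 r2 r3] [d1 d2 d3] [v1 v2 v3]]]]]] :=
  @factor_through_conics _ a X xlineX k => //; first exact: u4.
  have [gs szgs Hgs] := ideal_span xlineX k; move/Hgs.
  suff -> : gs = [::] by [].
  by apply: size0nil; rewrite szgs big_ord_recr /= big1 ?uk // => j _; apply: u0.
have {}qd : tdeg_lt (k - 1) q by move: qd; rewrite subn1 subn2.
pose Y := [seq A <- X | eval2 q A != 0]; pose Z := [seq A <- X | eval2 q A == 0].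
have YX : {subset Y <= X} by apply: mem_subseq (filter_subseq _ _).
have ZX : {subset Z <= X} by apply: mem_subseq (filter_subseq _ _).
have szY : (size Y <= 3)%N.
  have vY M : vanish X (q * M) -> vanish Y M.
    move=> vM A; rewrite mem_filter => /andP[qA /vM/eqP].
    by rewrite eval2M mulf_eq0 (negPf qA) => /eqP.
  (* The nodes off [q] lie on the three conics, whose restrictions have degrees [0], [1], [2]. The
     dimensions from index [3] on are then at least [3, 4, 5, ...], which leaves [1 + 2] for the
     nodes of [Y]. *)
  have Y3 : (3 <= restr_dim a Y 3)%N.
    rewrite /restr_dim; apply: (@uniq_leq_size _ [:: 0; 1; 2]%N) => // e.
    have sz M e' : tdeg_lt 3 M -> vanish X (q * M) -> restr a M = 'X^e' ->
        e' \in restr_degs a Y 3.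
      move=> Md /vY vM rM; rewrite mem_restr_degs; apply/is_restr_degP.
      by exists M => //; rewrite rM size_polyXn.
    by rewrite !inE => /or3P[] /eqP ->;
      [apply: (sz M1)|apply: (sz M2)|apply: (sz M3)].
  have := @independent_size _ a Y n.+1
    (filter_uniq _ Xu) (independent_sub YX Xn).
  have := sum_restr_dim (n - 1) (isT : (0 < 3)%N) Y3.
  rewrite -bin2_sum big_mkord (_ : n.+2 = 3 + (n - 1))%N; last lia.
  rewrite !big_split_ord /= 6!big_ord_recl !big_ord0 /=.
  rewrite /bump /=.
  by set t1 := (\sum_(i < _) _)%N; set t2 := (\sum_(i < _) _)%N; lia.
have szZ : (size Z <= dnk n (k - 2))%N.
  apply: (@size_on_curve a Z n k q) => //; first exact: filter_uniq.
    exact: independent_sub ZX Xn.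
  by move=> A; rewrite mem_filter => /andP[/eqP].
have := count_predC (fun A => eval2 q A == 0) X.
rewrite szX -[count _ X]size_filter -[count (predC _) X]size_filter -/Y -/Z => szYZ.
exists q; split=> //; last 2 first.
- by rewrite -size_filter -/Y; lia.
- by rewrite -size_filter -/Z; lia.
by apply: contraNneq q0 => ->; rewrite restr0.
Qed.

End Dimensions.

End NodeCounts.

(** * Linearly independent families and multiples of a given curve *)

Section Families.

Variable F : fieldType.

Implicit Types (p q f g : {poly {poly F}}) (X : seq (F * F)).

Definition lin_free m (G : 'I_m -> {poly {poly F}}) : Prop :=
  forall v : 'I_m -> F, \sum_i scal (v i) * G i = 0 -> forall i, v i = 0.

Lemma lin_free_leq a X d m (G : 'I_m -> {poly {poly F}}) :
  (forall A, A \in X -> A.1 != a) ->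
  (forall i, ideal_lt X d (G i)) -> lin_free G ->
  (m <= \sum_(j < d.+1) restr_dim a X j)%N.
Proof.
move=> aX Gd Gfree; have [gs <- Hgs] := ideal_span aX d.
rewrite leqNgt; apply/negP=> gsm.
have [i|v [i /eqP vi] vG] := inspan_dependent gsm (G := G); first exact/Hgs/Gd.
exact/vi/Gfree.
Qed.

Definition mono (e : nat * nat) : {poly {poly F}} := 'X^(e.1) * ('X^(e.2))%:P.

Lemma coef_mono e i j : (mono e)`_i`_j = (e == (i, j))%:R.
Proof.
case: e => e1 e2; rewrite /mono coefMC coefXn mulrC xpair_eqE eq_sym.
case: eqVneq => _ /=; last by rewrite mulr0 coef0.
by rewrite mulr1 coefXn eq_sym.
Qed.

Lemma tdeg_lt_mono e d : (e.1 + e.2 < d)%N -> tdeg_lt d (mono e).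
Proof.
case: e => e1 e2 /= ed i j ij; rewrite coef_mono xpair_eqE.
by case: eqP => // e1i; case: eqP => // e2j; exfalso; lia.
Qed.

Definition mono_comb (es : seq (nat * nat)) (c : 'I_(size es) -> F) :=
  \sum_j scal (c j) * mono (tnth (in_tuple es) j).

Lemma mono_comb_eq0 es (c : 'I_(size es) -> F) : uniq es ->
  mono_comb c = 0 -> forall j, c j = 0.
Proof.
move=> esu c0 j; case ej: (tnth (in_tuple es) j) => [e1 e2].
have := congr1 (fun p : {poly {poly F}} => p`_e1`_e2) c0; rewrite /= !coef0 => <-.
rewrite !coef_sum (bigD1 j) //= big1 => [|i ij].
  by rewrite !coefCM coef_mono ej eqxx mulr1 addr0.
rewrite !coefCM coef_mono -ej (inj_eq (elimT (tuple_uniqP (in_tuple es)) esu)).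
by rewrite (negPf ij) mulr0.
Qed.

(** The rows of [K] are coefficient vectors on distinct monomials, and multiplication by the nonzero
    [q] is injective. *)
Lemma lin_free_mono_comb es m (K : 'M[F]_(m, size es)) q : uniq es -> q != 0 ->
  row_free K -> lin_free (fun i => mono_comb (K i) * q).
Proof.
move=> esu q0 Kfree v vK.
pose w : 'rV_m := \row_i v i.
have wK : w *m K = 0.
  apply/rowP=> j; rewrite [RHS]mxE.
  apply: (mono_comb_eq0 (c := (w *m K) 0)) => //.
  apply: (mulIf q0); rewrite mul0r -vK.
  transitivity (\sum_i (scal (v i) * mono_comb (K i)) * q); last first.
    by apply: eq_bigr => i _; rewrite mulrA.
  rewrite -big_distrl /=; congr (_ * q).
  under [RHS]eq_bigr => i _ do rewrite big_distrr /=.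
  rewrite exchange_big /=; apply: eq_bigr => l _.
  rewrite mxE /scal !rmorph_sum big_distrl /=; apply: eq_bigr => i _.
  by rewrite mxE !polyCM mulrA.
move=> i; have /row_freeP[K' KK'] := Kfree.
have /rowP/(_ i) : w = 0 by rewrite -[w]mulmx1 -KK' mulmxA wK mul0mx.
by rewrite !mxE.
Qed.

Lemma tdeg_lt_mono_comb es (c : 'I_(size es) -> F) d :
  all (fun e => e.1 + e.2 < d)%N es -> tdeg_lt d (mono_comb c).
Proof.
move=> /allP esd; apply: tdeg_lt_sum => j; apply: tdeg_ltZ.
by apply: tdeg_lt_mono; apply: esd; apply: mem_tnth.
Qed.

Lemma three_multiples X d q : q != 0 -> ideal_lt X d q ->
  exists2 G : 'I_3 -> {poly {poly F}},
    forall i, ideal_lt X d.+1 (G i) & lin_free G.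
Proof.
(* The three multiples are [q] times [1], the abscissa and the ordinate. *)
move=> q0 qd; pose es := [:: (0, 0); (1, 0); (0, 1)]%N.
have f1 : row_free (1%:M : 'M[F]_(3, size es)) by rewrite row_free_unit unitmx1.
exists (fun i => mono_comb ((1%:M : 'M[F]_(3, size es)) i) * q).
  by move=> i; apply: (@ideal_ltM _ _ 1) => //; apply: tdeg_lt_mono_comb.
exact: (@lin_free_mono_comb es).
Qed.

(** Passing through the three nodes off [q] imposes three linear conditions on the six-dimensional
    space of conics; three independent solutions are multiplied by [q]. *)
Lemma three_conic_multiples X d q : q != 0 -> tdeg_lt d q ->
  count (fun A => eval2 q A != 0) X = 3%N ->
  exists2 G : 'I_3 -> {poly {poly F}},
    forall i, ideal_lt X d.+2 (G i) & lin_free G.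
Proof.
move=> q0 qd; rewrite -size_filter; set Y := filter _ X => szY.
pose es := [:: (0, 0); (1, 0); (0, 1); (2, 0); (1, 1); (0, 2)]%N.
pose E := \matrix_(j < size es, l < 3)
  eval2 (mono (tnth (in_tuple es) j)) (nth (0, 0) Y l).
pose r := \rank (kermx E).
have r3 : (3 <= r)%N.
  by rewrite /r mxrank_ker; have := rank_leq_col E; move: (\rank E) => t /=; lia.
(* [pid_mx 3] selects the first three rows of a basis of the kernel, whose rank [r] may exceed
   [3]. *)
pose K : 'M_(3, size es) := (pid_mx 3 : 'M_(3, r)) *m row_base (kermx E).
have Kfree : row_free K.
  by rewrite /row_free mxrankMfree ?row_base_free // rank_pid_mx.
have KE : K *m E = 0.
  rewrite -mulmxA (_ : row_base _ *m E = 0) ?mulmx0 //.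
  by apply/sub_kermxP; rewrite eq_row_base.
exists (fun i => mono_comb (K i) * q); last exact: lin_free_mono_comb.
move=> i; split.
  apply: (@tdeg_ltM _ 2) => //; exact: tdeg_lt_mono_comb.
move=> A AX; rewrite eval2M; have [->|qA] := eqVneq (eval2 q A) 0.
  by rewrite mulr0.
have AY : A \in Y by rewrite mem_filter qA.
have iA : (index A Y < 3)%N by rewrite -szY index_mem.
have /matrixP/(_ i (Ordinal iA)) := KE; rewrite !mxE => KEi.
rewrite [X in X * _](_ : _ = 0) ?mul0r //.
rewrite /mono_comb eval2_sum -[RHS]KEi; apply: eq_bigr => j _.
by rewrite [E _ _]mxE eval2M eval2_scal /= nth_index.
Qed.

End Families.

(** * Translation between [{mpoly R[2]}] and nested polynomials *)

Section Transfer.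

Variable R : realType.

Implicit Types (p : {mpoly R[2]}) (q : {poly {poly R}}) (X : seq (R * R)).

Definition mnm2 (i j : nat) : 'X_{1..2} :=
  [multinom (if val l == 0%N then i else j) | l < 2].

Lemma mnm2E (m : 'X_{1..2}) : m = mnm2 (m ord0) (m ord_max).
Proof.
by apply/mnmP=> l; rewrite mnmE; case: l => [[|[|//]]] ? /=; congr (m _);
  apply: val_inj.
Qed.

Lemma mnm2_inj i j i' j' : (mnm2 i j == mnm2 i' j') = (i == i') && (j == j').
Proof.
apply/eqP/andP=> [|[/eqP -> /eqP -> //]] /mnmP mE.
by have := mE ord0; have := mE ord_max; rewrite !mnmE /= => -> ->.
Qed.

Lemma mdeg_mnm2 i j : mdeg (mnm2 i j) = (i + j)%N.
Proof. by rewrite mdegE !big_ord_recl big_ord0 !mnmE /= addn0. Qed.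

(** Truncating both exponents at [msize p] loses nothing, since each is at most the total degree. *)
Definition biv p : {poly {poly R}} :=
  \poly_(i < msize p) \poly_(j < msize p) p@_(mnm2 i j).

Definition unbiv q : {mpoly R[2]} :=
  \sum_(i < size q) \sum_(j < size q`_i) q`_i`_j *: 'X_[mnm2 i j].

Lemma coef_biv p i j : (biv p)`_i`_j = p@_(mnm2 i j).
Proof.
have big l : (msize p <= l)%N -> (l <= i + j)%N -> p@_(mnm2 i j) = 0.
  move=> pl lij; apply/eqP; rewrite mcoeff_eq0; apply/negP=> /msize_mdeg_lt.
  by rewrite mdeg_mnm2; lia.
rewrite coef_poly; case: ltnP => pi; last by rewrite coef0 (big i) //; lia.
by rewrite coef_poly; case: ltnP => // pj; rewrite (big j) //; lia.
Qed.

Lemma mcoeff_unbiv q i j : (unbiv q)@_(mnm2 i j) = q`_i`_j.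
Proof.
rewrite /unbiv raddf_sum /=.
under eq_bigr => i' _ do rewrite raddf_sum /=.
under eq_bigr => i' _ do under eq_bigr => j' _ do
  rewrite mcoeffZ mcoeffX mnm2_inj.
have [qi|iq] := leqP (size q) i.
  rewrite (nth_default 0 qi) coef0 big1 // => i' _; rewrite big1 // => j' _.
  by rewrite [_ == i]ltn_eqF ?mulr0 // (leq_trans (ltn_ord i')).
rewrite (bigD1 (Ordinal iq)) //= [X in _ + X]big1 ?addr0 => [|i' ii']; last first.
  rewrite big1 // => j' _.
  have /negPf -> : (i' != i :> nat) by apply: contra_neq ii' => ii'; apply: val_inj.
  by rewrite mulr0.
have [qj|jq] := leqP (size q`_i) j.
  rewrite [RHS]nth_default // big1 // => j' _.
  by rewrite [_ == j]ltn_eqF ?andbF ?mulr0 // (leq_trans (ltn_ord j')).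
rewrite (bigD1 (Ordinal jq)) //= !eqxx mulr1 big1 ?addr0 // => j' jj'.
have /negPf -> : (j' != j :> nat) by apply: contra_neq jj' => jj'; apply: val_inj.
by rewrite andbF mulr0.
Qed.

Lemma unbivK q : biv (unbiv q) = q.
Proof. by apply/polyP=> i; apply/polyP=> j; rewrite coef_biv mcoeff_unbiv. Qed.

Lemma bivK p : unbiv (biv p) = p.
Proof. by apply/mpolyP=> m; rewrite [m]mnm2E mcoeff_unbiv coef_biv. Qed.

Lemma ev_biv p A : ev p A = eval2 (biv p) A.
Proof.
rewrite -{1}[p]bivK; move: (biv p) => q; rewrite /ev /unbiv /eval2.
rewrite raddf_sum [q.[_]]horner_coef horner_sum; apply: eq_bigr => i _.
rewrite raddf_sum /= -polyC_exp hornerM hornerC horner_coef big_distrl /=.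
apply: eq_bigr => j _; rewrite mevalZ mevalX !big_ord_recl big_ord0 !mnmE /=.
by rewrite mulr1; ring.
Qed.

Lemma msize_biv p d : (msize p <= d)%N <-> tdeg_lt d (biv p).
Proof.
split=> [pd i j dij|pd].
  rewrite coef_biv; apply/eqP; rewrite mcoeff_eq0; apply/negP=> /msize_mdeg_lt.
  by rewrite mdeg_mnm2 => /leq_trans/(_ pd); rewrite ltnNge dij.
rewrite msizeE; apply/bigmax_leqP_seq => m mp _; rewrite ltnNge; apply/negP=> dm.
move: mp; rewrite mcoeff_msupp [m]mnm2E -coef_biv pd ?eqxx //.
by rewrite -mdeg_mnm2 -mnm2E.
Qed.

Lemma biv_sum m (c : 'I_m -> R) (ps : 'I_m -> {mpoly R[2]}) :
  biv (\sum_i c i *: ps i) = \sum_i scal (c i) * biv (ps i).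
Proof.
apply/polyP=> i; apply/polyP=> j; rewrite coef_biv raddf_sum !coef_sum /=.
by apply: eq_bigr => l _; rewrite mcoeffZ !coefCM coef_biv.
Qed.

Lemma biv_eq0 p : (biv p == 0) = (p == 0).
Proof.
apply/eqP/eqP=> [p0|->].
  by apply/mpolyP=> m; rewrite [m]mnm2E -coef_biv p0 !coef0 mcoeff0.
by apply/polyP=> i; apply/polyP=> j; rewrite coef_biv mcoeff0 !coef0.
Qed.

Lemma vanishes_biv X p : vanishes_on X p <-> vanish X (biv p).
Proof. by split=> pX A /pX; rewrite ev_biv. Qed.

Lemma independent_biv n X : n_independent n X -> independent X n.+1.
Proof.
move=> Xn A /Xn[p [pn [p1 p0]]]; exists (biv p); first exact/msize_biv.
by split=> [|B BX BA]; rewrite -ev_biv //; apply: p0.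
Qed.

Lemma lin_indep_biv (ps : seq {mpoly R[2]}) :
  lin_indep ps -> lin_free (fun i : 'I_(size ps) => biv ps`_i).
Proof.
move=> psi v /eqP; rewrite -biv_sum biv_eq0 => /eqP; exact: psi.
Qed.

Lemma unbiv_family X d (G : 'I_3 -> {poly {poly R}}) :
  (forall i, ideal_lt X d.+1 (G i)) -> lin_free G ->
  exists ps : seq {mpoly R[2]}, [/\ size ps = 3%N, all (inPi d) ps,
    (forall p, p \in ps -> vanishes_on X p) & lin_indep ps].
Proof.
move=> Gd Gfree; exists (mkseq (fun i => unbiv (G (inord i))) 3).
have mem p : p \in mkseq (fun i => unbiv (G (inord i))) 3 ->
    exists i, p = unbiv (G i) by case/mapP=> i _ ->; exists (inord i).
split=> //.
- apply/allP=> p /mem[i ->]; apply/msize_biv; rewrite unbivK; exact: (Gd i).1.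
- move=> p /mem[i ->]; apply/vanishes_biv; rewrite unbivK; exact: (Gd i).2.
move=> c c0 i; apply: (Gfree c); rewrite -[RHS](_ : biv 0 = 0); last first.
  by apply/eqP; rewrite biv_eq0.
rewrite -c0 biv_sum; apply: eq_bigr => j _.
by rewrite nth_mkseq // inord_val unbivK.
Qed.

(* Multiplying by powers of a line that misses [X] adjusts the degree without
   changing the zeros in [X]. *)
Lemma exists_curve a X d q : (forall A, A \in X -> A.1 != a) ->
  q != 0 -> tdeg_lt d.+1 q ->
  exists p, curve d p /\ {in X, forall A, (ev p A == 0) = (eval2 q A == 0)}.
Proof.
move=> aX q0 qd; have [i [pd npd]] := exists_exact_degree a q0 qd.
exists (unbiv (xline a ^+ i * q)); split.
  rewrite /curve -biv_eq0 unbivK mulf_neq0 ?expf_neq0 ?xline_neq0 //=.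
  rewrite eqn_leq ltnNge; apply/andP; split.
    by apply/msize_biv; rewrite unbivK.
  by apply/negP=> /msize_biv; rewrite unbivK.
move=> A AX; rewrite ev_biv unbivK eval2M mulf_eq0.
suff /negPf -> : eval2 (xline a ^+ i) A != 0 by [].
elim: i {pd npd} => [|i IH]; first by rewrite expr0 eval2_scal oner_neq0.
by rewrite exprS eval2M mulf_neq0 // eval2_xline subr_eq0 aX.
Qed.

Lemma exists_missing_line X :
  exists a, forall A, A \in X -> A.1 != a.
Proof.
(* This abscissa exceeds that of every node. *)
exists (1 + \sum_(A <- X) `|A.1|) => A AX.
apply: contra_eq_neq (erefl A.1) => {2}->.
suff : A.1 < 1 + \sum_(A0 <- X) `|A0.1| by rewrite lt_neqAle => /andP[].
rewrite ltr_pwDl // (big_rem A) //= (le_trans (ler_norm _)) // lerDl.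
by apply: sumr_ge0.
Qed.

End Transfer.

Theorem mainTheorem2 (R : realType) (n k : nat) (X : seq (R * R)) :
  (3 <= k)%N -> (k <= n - 2)%N ->
  uniq X -> n_independent n X -> size X = (dnk n (k - 2) + 3)%N ->
  (forall ps : seq {mpoly R[2]},
     all (inPi k) ps -> (forall p, p \in ps -> vanishes_on X p) ->
     lin_indep ps -> (size ps <= 3)%N) /\
  ((exists ps : seq {mpoly R[2]},
      [/\ size ps = 3%N, all (inPi k) ps,
          (forall p, p \in ps -> vanishes_on X p) & lin_indep ps])
   <->
   ((exists q : {mpoly R[2]}, curve (k - 1) q /\ vanishes_on X q)
    \/ (exists q : {mpoly R[2]},
          [/\ curve (k - 2) q,
              count (fun A => ev q A != 0) X = 3%N
            & maximal_curve n X (k - 2) q]))).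
Proof.
move=> k3 kn Xu /independent_biv Xn szX.
have [a aX] := exists_missing_line X.
(* [inPi k] is the strict bound [k.+1], hence the sum over [j < k.+2]. *)
have bound ps : all (inPi k) ps -> (forall p, p \in ps -> vanishes_on X p) ->
    lin_indep ps -> (size ps <= \sum_(j < k.+2) restr_dim a X j)%N.
  move=> /allP psk psX /lin_indep_biv; apply: lin_free_leq => // i; split.
    by apply/msize_biv/psk/mem_nth.
  by apply/vanishes_biv/psX/mem_nth.
split=> [ps psk psX psi|].
  apply: leq_trans (bound ps psk psX psi) _.
  exact: (sum_restr_dim_le3 a k3 kn Xu Xn szX).
have curve_neq0 d (q : {mpoly R[2]}) : curve d q -> biv q != 0.
  by rewrite biv_eq0 => /andP[].
have curve_deg d (q : {mpoly R[2]}) : curve d q -> tdeg_lt d.+1 (biv q).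
  by case/andP=> _ /eqP szq; apply/msize_biv; rewrite szq.
split=> [[ps [sz3 psk psX psi]]|].
  have [] := @curve_alternative _ a X n k aX k3 kn Xu Xn szX.
  - by rewrite -sz3; apply: bound.
  (* The alternatives only bound the degree of [q]; [exists_curve] pads it to exactly [k - 1] here
     and [k - 2] below. *)
  - move=> [q q0 [qk qX]]; left; have kE : k = (k - 1).+1 by lia.
    rewrite kE in qk; have [p [pk pq]] := exists_curve aX q0 qk.
    by exists p; split=> // A AX; apply/eqP; rewrite pq // qX.
  - move=> [q [q0 qk off on]]; right; have kE : (k - 1 = (k - 2).+1)%N by lia.
    rewrite kE in qk; have [p [pk pq]] := exists_curve aX q0 qk.
    exists p; split=> //; last split=> //.
      by rewrite -off; apply: eq_in_count => A AX; rewrite pq.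
    by rewrite -on; apply: eq_in_count => A AX; rewrite pq.
case=> [[q [qk qX]]|[q [qk off _]]].
  have [|G Gd Gfree] := @three_multiples _ X k (biv q) (curve_neq0 _ _ qk).
    split; last exact/vanishes_biv.
    by have := curve_deg _ _ qk; have -> : (k - 1).+1 = k by lia.
  exact: unbiv_family Gd Gfree.
have [|G Gd Gfree] :=
  three_conic_multiples (curve_neq0 _ _ qk) (curve_deg _ _ qk) (X := X).
  by rewrite -off; apply: eq_in_count => A AX; rewrite ev_biv.
have kE : (k - 2).+3 = k.+1 by lia.
rewrite kE in Gd; exact: unbiv_family Gd Gfree.
Qed.
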